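(* For every positive integer $n$, the $1$-factor $nK_2$ is power-critical, and the cyclic group $\mathbb{Z}_{2n}$ is $nK_2$-optimal.
   Context: Graphs are finite, simple and undirected. The power graph $\Gamma_G$ of a group $G$ has vertex set $G$, and two distinct elements are adjacent if one is a power of the other. An embedding of a graph $\Gamma_1$ into a graph $\Gamma_2$ is an injection $f:V(\Gamma_1)\to V(\Gamma_2)$ such that $\{x,y\}\in E(\Gamma_1)$ implies $\{f(x),f(y)\}\in E(\Gamma_2)$ (the image need not be an induced subgraph). The power index $\Theta(\Gamma)$ of a graph $\Gamma$ is the least order of a group $G$ such that $\Gamma$ embeds into $\Gamma_G$. A group $G$ is $\Gamma$-optimal if $\Gamma$ embeds into $\Gamma_G$ and $|G|=\Theta(\Gamma)$. A graph $\Gamma$ is power-critical if $|V(\Gamma)|=\Theta(\Gamma)$. The graph $nK_2$ (the $1$-factor) is the disjoint union of $n$ copies of $K_2$. *)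

(* Defs.v *)
From HB Require Import structures.
From mathcomp Require Import all_boot all_algebra all_fingroup all_solvable.
From mathcomp Require Import boolp.

Set Implicit Arguments.
Unset Strict Implicit.
Unset Printing Implicit Defensive.

Import GroupScope.

Record sgraph := SGraph {
  vertex : finType;
  adj : rel vertex;
  adj_sym : symmetric adj;
  adj_irr : irreflexive adj
}.

Definition embeds (g1 g2 : sgraph) : Prop :=
  exists f : vertex g1 -> vertex g2,
    injective f /\ forall x y, adj x y -> adj (f x) (f y).

Section CompleteGraph.
Variable T : finType.

Definition complete_adj : rel T := fun x y => x != y.

Lemma complete_adj_sym : symmetric complete_adj.
Proof. by move=> x y; rewrite /complete_adj eq_sym. Qed.

Lemma complete_adj_irr : irreflexive complete_adj.
Proof. by move=> x; rewrite /complete_adj eqxx. Qed.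

Definition complete_graph : sgraph := SGraph complete_adj_sym complete_adj_irr.

End CompleteGraph.

Section Copies.
Variables (n : nat) (g : sgraph).

Definition copies_adj : rel ('I_n * vertex g)%type :=
  fun u v => (u.1 == v.1) && adj u.2 v.2.

Lemma copies_adj_sym : symmetric copies_adj.
Proof. by move=> u v; rewrite /copies_adj eq_sym adj_sym. Qed.

Lemma copies_adj_irr : irreflexive copies_adj.
Proof. by move=> u; rewrite /copies_adj adj_irr andbF. Qed.

Definition copies : sgraph := SGraph copies_adj_sym copies_adj_irr.

End Copies.

Definition one_factor (n : nat) : sgraph := copies n (complete_graph 'I_2).

Section PowerGraph.
Variable gT : finGroupType.

(* Natural exponents suffice, as the elements have finite order. *)
Definition is_power_of (y x : gT) : Prop := exists k : nat, y = x ^+ k.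

Definition power_adj : rel gT :=
  fun x y => (x != y) && `[< is_power_of y x \/ is_power_of x y >].

Lemma power_adj_sym : symmetric power_adj.
Proof.
move=> x y; rewrite /power_adj eq_sym; congr (_ && _).
by apply/asboolP/asboolP => -[]; [right | left | right | left].
Qed.

Lemma power_adj_irr : irreflexive power_adj.
Proof. by move=> x; rewrite /power_adj eqxx. Qed.

Definition power_graph : sgraph := SGraph power_adj_sym power_adj_irr.

Lemma power_adjE (x y : gT) :
  power_adj x y = (x != y) && ((y \in <[x]>) || (x \in <[y]>)).
Proof.
congr (_ && _); apply/asboolP/orP => -[].
- by move=> /cycleP ?; left.
- by move=> /cycleP ?; right.
- by move=> /cycleP ?; left.
- by move=> /cycleP ?; right.
Qed.

Lemma power_adj_prime (x y : gT) :
  prime #|gT| -> x != y -> power_adj x y.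
Proof.
move=> pr_gT; have cycle_full (z : gT) : z != 1 -> <[z]> = setT.
  move=> nt_z; apply/eqP; rewrite eqEcard subsetT cardsT /=.
  have dvd_z : #[z] %| #|gT| by rewrite -cardsT order_dvdG ?inE.
  have nt_oz : #[z] != 1%N by rewrite order_eq1.
  by rewrite -(prime_nt_dvdP pr_gT nt_oz dvd_z).
rewrite power_adjE => neq_xy; rewrite neq_xy /=.
have [x1 | nt_x] := eqVneq x 1; first by rewrite x1 group1 orbT.
by rewrite (cycle_full _ nt_x) inE.
Qed.

End PowerGraph.

Definition embeds_in_order (g : sgraph) (k : nat) : Prop :=
  exists gT : finGroupType, #|gT| = k /\ embeds g (power_graph gT).

(* The power graph of a group of prime order is complete. *)
Lemma embeds_in_order_ex (g : sgraph) :
  exists k : nat, `[< embeds_in_order g k >].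
Proof.
have [p lt_g_p pr_p] := prime_above #|vertex g|.
have p_gt1 := prime_gt1 pr_p.
have card_Zp : #|'Z_p| = p by rewrite card_ord Zp_cast.
exists p; apply/asboolP; exists 'Z_p; split=> //.
have le_g_Zp : #|vertex g| <= #|'Z_p| by rewrite card_Zp ltnW.
pose f (x : vertex g) : 'Z_p := enum_val (widen_ord le_g_Zp (enum_rank x)).
have f_inj : injective f.
  by move=> x y /enum_val_inj/(congr1 val) /= /ord_inj/enum_rank_inj.
exists f; split=> // x y adj_xy; apply: power_adj_prime; first by rewrite card_Zp.
by apply: contraTneq adj_xy => /f_inj ->; rewrite adj_irr.
Qed.

(* Only finite groups compete: by [embeds_in_order_ex] the least order is
   always finite. *)
Definition power_index (g : sgraph) : nat := ex_minn (embeds_in_order_ex g).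

Definition optimal (g : sgraph) (gT : finGroupType) : Prop :=
  embeds g (power_graph gT) /\ #|gT| = power_index g.

Definition power_critical (g : sgraph) : Prop := #|vertex g| = power_index g.

(* Main.v *)
(** Both claims amount to a perfect matching in the power graph of [Z_2n]:
    match [x] with [-x], which generates the same subgroup, and match the two
    self-inverse elements [0] and [n] with each other, [0] being a multiple of
    every element. *)

Require Import Defs.
From mathcomp Require Import all_boot all_algebra all_fingroup all_solvable.
From mathcomp Require Import boolp zify.

Set Implicit Arguments.
Unset Strict Implicit.
Unset Printing Implicit Defensive.

Lemma card_one_factor n : #|vertex (one_factor n)| = 2 * n.
Proof. by rewrite card_prod !card_ord mulnC. Qed.

Lemma embeds_in_order_geq g k : embeds_in_order g k -> #|vertex g| <= k.
Proof. by case=> gT [<-] [f [/leq_card]]. Qed.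

(** Injectivity bounds the order of every competing group below by the number of vertices, so a
    group that attains this bound realises the minimum. *)
Lemma power_index_spanning (g : sgraph) (gT : finGroupType) :
  embeds g (power_graph gT) -> #|gT| = #|vertex g| ->
  power_index g = #|vertex g|.
Proof.
move=> emb card_gT; rewrite /power_index.
case: ex_minnP => k /asboolP/embeds_in_order_geq le_g_k min_k.
apply/eqP; rewrite eqn_leq le_g_k andbT min_k //.
by apply/asboolP; exists gT.
Qed.

(** Edge [i] joins [i] to its negative [2 * n - i]; edge [0] joins the two self-inverse residues.
    Natural-number values leave the arithmetic to [lia]. *)
Definition matching_index n (u : 'I_n * 'I_2) : nat :=
  if u.2 == 0 :> nat then nat_of_ord u.1 else if u.1 == 0 :> nat then n else 2 * n - u.1.

Lemma matching_index_lt n (u : 'I_n * 'I_2) : matching_index u < 2 * n.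
Proof. by rewrite /matching_index; have := ltn_ord u.1; do ?case: ifP; lia. Qed.

(** Ends [0] fill the values below [n]; ends [1] take [n] on edge [0] and values strictly above [n]
    on the others. *)
Lemma matching_index_inj n : injective (@matching_index n).
Proof.
move=> [i a] [j b]; rewrite /matching_index /= => eq_ij.
have lt_i := ltn_ord i; have lt_j := ltn_ord j.
have lt_a := ltn_ord a; have lt_b := ltn_ord b.
by congr (_, _); apply: val_inj => /=; move: eq_ij; do ?case: ifP; lia.
Qed.

Lemma power_adj_cycle_eq (gT : finGroupType) (x y : gT) :
  x != y -> <[x]>%g = <[y]>%g -> power_adj x y.
Proof. by move=> neq_xy eq_xy; rewrite power_adjE neq_xy -eq_xy cycle_id orbT. Qed.

Lemma power_adj_1l (gT : finGroupType) (x : gT) : (1 != x -> power_adj 1 x)%g.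
Proof. by move=> nt_x; rewrite power_adjE nt_x group1 orbT. Qed.

Lemma embeds_one_factor_Zp n :
  0 < n -> embeds (one_factor n) (power_graph 'Z_(2 * n)).
Proof.
(* ['Z_m] has [m] elements only for [m > 1], whence the use of [n_gt0]. *)
move=> n_gt0; have ZpE : (Zp_trunc (2 * n)).+2 = 2 * n by rewrite Zp_cast //; lia.
pose f (u : 'I_n * 'I_2) : 'Z_(2 * n) := inZp (matching_index u).
have val_f u : f u = matching_index u :> nat.
  by rewrite /= modn_small // ZpE matching_index_lt.
have f_inj : injective f.
  by move=> u v eq_uv; apply: matching_index_inj; rewrite -!val_f eq_uv.
have adj_f (i : 'I_n) (a b : 'I_2) :
    a = 0 :> nat -> b = 1%N :> nat -> power_adj (f (i, a)) (f (i, b)).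
  move=> a0 b1; have neq_f : f (i, a) != f (i, b).
    by apply/eqP => /f_inj[eq_ab]; move: b1; rewrite -eq_ab a0.
  have val_a : f (i, a) = i :> nat by rewrite val_f /matching_index a0.
  have [i0 | nz_i] := eqVneq (i : nat) 0.
    (* The group law is addition, so [1%g] is the residue [0]. *)
    have f1 : f (i, a) = 1%g by apply: ord_inj; rewrite val_a i0.
    by rewrite f1 in neq_f *; apply: power_adj_1l.
  (* It remains to see that [f (i, b)] is the inverse of [f (i, a)]. *)
  apply: power_adj_cycle_eq => //; rewrite -cycleV; congr <[_]>%g.
  have valV (x : 'Z_(2 * n)) : (x^-1)%g = (2 * n - x) %% (2 * n) :> nat.
    by case: x => x lt_x; rewrite /= ZpE.
  apply: ord_inj; rewrite valV val_a val_f /matching_index /= b1 (negPf nz_i).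
  by rewrite modn_small //; have := ltn_ord i; lia.
exists f; split=> // [] [i a] [j b] /andP[/= /eqP <-].
rewrite /complete_adj -val_eqE /=.
case: (a) (b) => [[|[|//]] lt_a] [[|[|//]] lt_b] //= _; first exact: adj_f.
by rewrite power_adj_sym adj_f.
Qed.

Theorem theorem4p5 (n : nat) (n_gt0 : 0 < n) :
  power_critical (one_factor n) /\ optimal (one_factor n) 'Z_(2 * n).
Proof.
have emb := embeds_one_factor_Zp n_gt0.
have card_Z : #|'Z_(2 * n)| = #|vertex (one_factor n)|.
  by rewrite card_one_factor card_ord Zp_cast //; lia.
by rewrite /power_critical /optimal (power_index_spanning emb card_Z).
Qed.
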